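(* Let $\mathfrak{B}$ be a unital C$^*$-algebra, let $I\subseteq\mathbb{Z}$ be a totally ordered index set, let $(\mathcal{E}_i)_{i\in I}$ be a family of semi-inner product $\mathfrak{B}$-bimodules, let $\mathcal{E}^m$ be their monotonic product, and let $\lambda_i:\mathcal{L}(\mathfrak{B}\oplus\mathcal{E}_i)\to\mathcal{L}(\mathcal{E}^m)$ ($i\in I$) be the associated representations. Then the algebras $\{\lambda_i(\mathcal{L}(\mathfrak{B}\oplus\mathcal{E}_i))\}_{i\in I}$ are monotonically independent in $\mathcal{L}(\mathcal{E}^m)$ with respect to the conditional expectation $\Phi(\cdot)=\langle 1,\cdot\,1\rangle$.
   Context: A semi-inner product $\mathfrak{B}$-bimodule is a linear space $\mathcal{E}$ which is a $\mathfrak{B}$-bimodule, together with a map $\langle\cdot,\cdot\rangle:\mathcal{E}\times\mathcal{E}\to\mathfrak{B}$ such that: (i) $\langle x,\alpha y+\beta z\rangle=\alpha\langle x,y\rangle+\beta\langle x,z\rangle$ for $x,y,z\in\mathcal{E}$, $\alpha,\beta\in\mathbb{C}$; (ii) $\langle x,ya\rangle=\langle x,y\rangle a$ for $x,y\in\mathcal{E}$, $a\in\mathfrak{B}$; (iii) $\langle y,x\rangle=\langle x,y\rangle^*$; (iv) $\langle x,x\rangle\ge0$. $\mathcal{L}(\mathcal{E})$ is the algebra of $\mathfrak{B}$-linear (not necessarily bounded) operators on $\mathcal{E}$, where $\mathfrak{B}$-linear means $T(b_1xb_2+y)=b_1T(x)b_2+T(y)$ for $b_1,b_2\in\mathfrak{B}$.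 $\mathfrak{B}$ itself is a bimodule with $\langle a,b\rangle=a^*b$. Monotonic product. With all tensor products amalgamated over $\mathfrak{B}$, $$\mathcal{E}^m=\mathfrak{B}\oplus\bigoplus_{n\ge1}\ \bigoplus_{\substack{i_1,\dots,i_n\in I\\ i_1>\dots>i_n}}\mathcal{E}_{i_1}\otimes\cdots\otimes\mathcal{E}_{i_n},$$ with $\langle f_1\otimes\cdots\otimes f_n,e_1\otimes\cdots\otimes e_m\rangle=\delta_{m,n}\langle f_n,\langle f_{n-1},\dots\langle f_1,e_1\rangle\cdots e_{n-1}\rangle e_n\rangle$ (different summands being orthogonal); $1$ denotes the unit of $\mathfrak{B}\subset\mathcal{E}^m$. For $i\in I$ let $\mathcal{E}^m_{(<i)}$ (resp. $\mathcal{E}^m_{(>i)}$) be the direct sum of those summands with $n\ge1$ and $i_1<i$ (resp. $i_1>i$). There is a natural identification $$\mathcal{E}^m=\big((\mathfrak{B}\oplus\mathcal{E}_i)\otimes_{\mathfrak{B}}(\mathfrak{B}\oplus\mathcal{E}^m_{(<i)})\big)\oplus\mathcal{E}^m_{(>i)},$$ and $\lambda_i(A)=(A\otimes I_{\mathfrak{B}\oplus\mathcal{E}^m_{(<i)}})\oplus 0_{\mathcal{E}^m_{(>i)}}$ for $A\in\mathcal{L}(\mathfrak{B}\oplus\mathcal{E}_i)$. Monotonic independence. A family $\{\mathfrak{A}_j\}_{j\in I}$ of subalgebras of $\mathfrak{A}=\mathcal{L}(\mathcal{E}^m)$ is monotonically independent (over $\mathfrak{B}$) with respect to $\Phi:\mathfrak{A}\to\mathfrak{B}$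 if, given $X_j\in\mathfrak{A}_j$ ($j\in I$), and with the elements $\Phi(X_j)\in\mathfrak{B}$ acting by left multiplication: (a) for all $i<j>k$ in $I$ and all $A,B\in\mathfrak{A}$, $\Phi(AX_iX_jX_kB)=\Phi(AX_i\Phi(X_j)X_kB)$; (b) for all $i_m>\dots>i_1<k_1<\dots<k_n$ in $I$: $\Phi(X_{i_m}\cdots X_{i_1})=\Phi(X_{i_m})\cdots\Phi(X_{i_1})$, $\Phi(X_{k_1}\cdots X_{k_n})=\Phi(X_{k_1})\cdots\Phi(X_{k_n})$, and $\Phi(X_{i_m}\cdots X_{i_1}X_{k_1}\cdots X_{k_n})=\Phi(X_{i_m})\cdots\Phi(X_{i_1})\Phi(X_{k_1})\cdots\Phi(X_{k_n})$. *)

(* Defs.v *)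
From HB Require Import structures.
From mathcomp Require Import all_boot all_order all_algebra.
From mathcomp Require Import complex.
From mathcomp Require Import boolp classical_sets cardinality fsbigop reals.
Set Implicit Arguments.
Unset Strict Implicit.
Unset Printing Implicit Defensive.
Import Order.TTheory GRing.Theory Num.Theory.
Local Open Scope quotient_scope.
Local Open Scope classical_set_scope.
Local Open Scope ring_scope.
Local Open Scope complex_scope.

(* Unital C*-algebras.  The norm is a field of the mixin, because the         *)
(* hierarchy has no join of normed modules with (non-commutative) algebras.   *)
HB.mixin Record isCStarAlgebra (R : realType) B of GRing.Algebra R[i] B := {
  cnorm : B -> R;
  star : B -> B;
  cnormD : forall a b, cnorm (a + b) <= cnorm a + cnorm b;
  cnormZ : forall (k : R[i]) a, (cnorm (k *: a))%:C = `|k| * (cnorm a)%:C;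
  cnorm_eq0 : forall a, cnorm a = 0 -> a = 0;
  cnormM : forall a b, cnorm (a * b) <= cnorm a * cnorm b;
  cnorm_complete : forall u : nat -> B,
    (forall e : R, 0 < e -> exists N : nat, forall m n : nat,
       (N <= m)%N -> (N <= n)%N -> cnorm (u m - u n) < e) ->
    exists l : B, forall e : R, 0 < e -> exists N : nat, forall n : nat,
       (N <= n)%N -> cnorm (u n - l) < e;
  starD : forall a b, star (a + b) = star a + star b;
  starZ : forall (k : R[i]) a, star (k *: a) = k^* *: star a;
  starM : forall a b, star (a * b) = star b * star a;
  starK : forall a, star (star a) = a;
  cnorm_star : forall a, cnorm (star a * a) = cnorm a ^+ 2 }.

#[short(type="cstarAlgType")]
HB.structure Definition CStarAlgebra (R : realType) :=
  {B of isCStarAlgebra R B & GRing.Algebra R[i] B}.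

Definition cstar_ge0 (R : realType) (B : cstarAlgType R) (a : B) : Prop :=
  exists c : B, a = star c * c.

HB.mixin Record isBimodule (K : comNzRingType) (B : algType K) E
    of GRing.Lmodule K E := {
  lact : B -> E -> E;
  ract : E -> B -> E;
  lactDl : forall a b x, lact (a + b) x = lact a x + lact b x;
  lactDr : forall a x y, lact a (x + y) = lact a x + lact a y;
  lactM : forall a b x, lact (a * b) x = lact a (lact b x);
  lact1 : forall x, lact 1 x = x;
  lactZ : forall (k : K) a x, lact (k *: a) x = k *: lact a x;
  ractDl : forall x y b, ract (x + y) b = ract x b + ract y b;
  ractDr : forall x a b, ract x (a + b) = ract x a + ract x b;
  ractM : forall x a b, ract x (a * b) = ract (ract x a) b;
  ract1 : forall x, ract x 1 = x;
  ractZ : forall (k : K) a x, ract x (k *: a) = k *: ract x a;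
  lract : forall a x b, ract (lact a x) b = lact a (ract x b) }.

#[short(type="bimodType")]
HB.structure Definition Bimodule (K : comNzRingType) (B : algType K) :=
  {E of isBimodule K B E & GRing.Lmodule K E}.

HB.mixin Record isSemiInner (R : realType) (B : cstarAlgType R) E
    of Bimodule R[i] B E := {
  ip : E -> E -> B;
  ip_linear : forall x y z (a b : R[i]),
    ip x (a *: y + b *: z) = a *: ip x y + b *: ip x z;
  ip_ract : forall x y (b : B), ip x (ract y b) = ip x y * b;
  ip_star : forall x y, ip y x = star (ip x y);
  ip_ge0 : forall x, cstar_ge0 (ip x x) }.

#[short(type="semiInnerBimodType")]
HB.structure Definition SemiInnerBimodule (R : realType) (B : cstarAlgType R) :=
  {E of isSemiInner R B E & Bimodule R[i] B E}.

Section BimoduleTheory.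
Variables (K : comNzRingType) (B : algType K).

Section Theory.
Variable E : bimodType B.
Implicit Types (x y : E) (a b : B).

Lemma lact0 a : lact a (0 : E) = 0.
Proof. by apply: (addIr (lact a 0)); rewrite -lactDr !add0r. Qed.
Lemma lact0l x : lact (0 : B) x = 0.
Proof. by apply: (addIr (lact 0 x)); rewrite -lactDl !add0r. Qed.
Lemma ract0 b : ract (0 : E) b = 0.
Proof. by apply: (addIr (ract 0 b)); rewrite -ractDl !add0r. Qed.
Lemma ract0r x : ract x (0 : B) = 0.
Proof. by apply: (addIr (ract x 0)); rewrite -ractDr !add0r. Qed.
Lemma lactN a x : lact a (- x) = - lact a x.
Proof. by apply: (addIr (lact a x)); rewrite -lactDr !addNr lact0. Qed.
Lemma ractN b x : ract (- x) b = - ract x b.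
Proof. by apply: (addIr (ract x b)); rewrite -ractDl !addNr ract0. Qed.
Lemma lact_scale k x : lact (k%:A : B) x = k *: x.
Proof. by rewrite lactZ lact1. Qed.
Lemma ract_scale k x : ract x (k%:A : B) = k *: x.
Proof. by rewrite ractZ ract1. Qed.
Lemma lactZr a k x : lact a (k *: x) = k *: lact a x.
Proof. by rewrite -!lact_scale -!lactM -scalerAr mulr1 -scalerAl mul1r. Qed.
Lemma ractZl b k x : ract (k *: x) b = k *: ract x b.
Proof. by rewrite -!ract_scale -!ractM -scalerAr mulr1 -scalerAl mul1r. Qed.

End Theory.

(* The algebra L(E) of B-linear operators is [set T | Blinear T]. *)
Definition Blinear (E : bimodType B) (T : E -> E) : Prop :=
  forall (b1 b2 : B) (x y : E),
    T (lact b1 (ract x b2) + y) = lact b1 (ract (T x) b2) + T y.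

Definition is_subalgebra (E : bimodType B) (A : set (E -> E)) : Prop :=
  [/\ A `<=` [set T | Blinear T],
      A (fun=> 0),
      (forall S T, A S -> A T -> A (fun x => S x + T x)),
      (forall (k : K) T, A T -> A (fun x => k *: T x)) &
      (forall S T, A S -> A T -> A (S \o T))].

(* B as a bimodule over itself; the alias keeps its actions apart from the    *)
(* ones a carrier may already have.                                           *)
Definition regular_bimod : Type := B.
HB.instance Definition _ := GRing.Lmodule.on regular_bimod.
HB.instance Definition _ :=
  @isBimodule.Build K B regular_bimod
    (fun a x => a * (x : B)) (fun x b => (x : B) * b)
    (fun a b x => mulrDl a b x) (fun a x y => mulrDr a x y)
    (fun a b x => esym (mulrA a b x)) (fun x => mul1r x)
    (fun k a x => esym (scalerAl k a x)) (fun x y b => mulrDl x y b)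
    (fun x a b => mulrDr x a b) (fun x a b => mulrA x a b)
    (fun x => mulr1 x) (fun k a x => esym (scalerAr k x a))
    (fun a x b => esym (mulrA a x b)).

Section DirectSum2.
Variables M N : bimodType B.

Let lact2 (a : B) (x : M * N) := (lact a x.1, lact a x.2).
Let ract2 (x : M * N) (a : B) := (ract x.1 a, ract x.2 a).

Fact lact2Dl a b x : lact2 (a + b) x = lact2 a x + lact2 b x.
Proof. by congr pair; exact: lactDl. Qed.
Fact lact2Dr a x y : lact2 a (x + y) = lact2 a x + lact2 a y.
Proof. by congr pair; exact: lactDr. Qed.
Fact lact2M a b x : lact2 (a * b) x = lact2 a (lact2 b x).
Proof. by congr pair; exact: lactM. Qed.
Fact lact21 x : lact2 1 x = x.
Proof. by case: x => x y; congr pair; exact: lact1. Qed.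
Fact lact2Z k a x : lact2 (k *: a) x = k *: lact2 a x.
Proof. by congr pair; exact: lactZ. Qed.
Fact ract2Dl x y b : ract2 (x + y) b = ract2 x b + ract2 y b.
Proof. by congr pair; exact: ractDl. Qed.
Fact ract2Dr x a b : ract2 x (a + b) = ract2 x a + ract2 x b.
Proof. by congr pair; exact: ractDr. Qed.
Fact ract2M x a b : ract2 x (a * b) = ract2 (ract2 x a) b.
Proof. by congr pair; exact: ractM. Qed.
Fact ract21 x : ract2 x 1 = x.
Proof. by case: x => x y; congr pair; exact: ract1. Qed.
Fact ract2Z k a x : ract2 x (k *: a) = k *: ract2 x a.
Proof. by congr pair; exact: ractZ. Qed.
Fact lract2 a x b : ract2 (lact2 a x) b = lact2 a (ract2 x b).
Proof. by congr pair; exact: lract. Qed.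

HB.instance Definition _ := isBimodule.Build K B (M * N)%type
  lact2Dl lact2Dr lact2M lact21 lact2Z ract2Dl ract2Dr ract2M ract21 ract2Z
  lract2.

End DirectSum2.

(* The amalgamated tensor product M (x)_B N: formal sums of elementary        *)
(* tensors modulo the congruence generated by biadditivity and                *)
(* x b (x) y = x (x) b y.                                                     *)
Section Tensor.
Variables M N : bimodType B.

Inductive tensor_rel : seq (M * N) -> seq (M * N) -> Prop :=
| tensor_refl s : tensor_rel s s
| tensor_sym s t : tensor_rel s t -> tensor_rel t s
| tensor_trans s t u : tensor_rel s t -> tensor_rel t u -> tensor_rel s u
| tensor_cat s s' t t' :
    tensor_rel s s' -> tensor_rel t t' -> tensor_rel (s ++ t) (s' ++ t')
| tensor_swap p q : tensor_rel [:: p; q] [:: q; p]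
| tensor_zero y : tensor_rel [:: (0, y)] [::]
| tensor_addl x x' y : tensor_rel [:: (x + x', y)] [:: (x, y); (x', y)]
| tensor_addr x y y' : tensor_rel [:: (x, y + y')] [:: (x, y); (x, y')]
| tensor_bal x b y : tensor_rel [:: (ract x b, y)] [:: (x, lact b y)].

Definition tensor_eqb (s t : seq (M * N)) : bool := `[< tensor_rel s t >].

Fact tensor_eqb_refl : reflexive tensor_eqb.
Proof. by move=> s; apply/asboolP; exact: tensor_refl. Qed.
Fact tensor_eqb_sym : symmetric tensor_eqb.
Proof. by move=> s t; apply/asboolP/asboolP => /tensor_sym. Qed.
Fact tensor_eqb_trans : transitive tensor_eqb.
Proof.
move=> t s u /asboolP st /asboolP tu; apply/asboolP; exact: tensor_trans st tu.
Qed.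

Canonical tensor_equiv :=
  EquivRel tensor_eqb tensor_eqb_refl tensor_eqb_sym tensor_eqb_trans.

Definition tensor : Type := {eq_quot tensor_equiv}.
HB.instance Definition _ := Choice.on tensor.
HB.instance Definition _ := Quotient.on tensor.

Definition tsum (s : seq (M * N)) : tensor := \pi_tensor s.
Definition tens (x : M) (y : N) : tensor := tsum [:: (x, y)].

Lemma tsumP s t : tsum s = tsum t <-> tensor_rel s t.
Proof. by split=> [/eqmodP/asboolP | st]; last apply/eqmodP/asboolP. Qed.

Lemma tsum_repr t : tsum (repr t) = t.
Proof. exact: reprK. Qed.

Lemma repr_tsum s : tensor_rel (repr (tsum s)) s.
Proof. by apply/tsumP; rewrite tsum_repr. Qed.


Lemma tensor_catC s t : tensor_rel (s ++ t) (t ++ s).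
Proof.
have H p u : tensor_rel (p :: u) (rcons u p).
  elim: u => [|q u IH]; first exact: tensor_refl.
  apply: (@tensor_trans _ (q :: p :: u)).
    apply: (@tensor_cat [:: p; q] [:: q; p] u u); first exact: tensor_swap.
    exact: tensor_refl.
  by apply: (@tensor_cat [:: q] [:: q]); [exact: tensor_refl | exact: IH].
elim: s t => [|p s IH] t; first by rewrite cats0; exact: tensor_refl.
apply: (@tensor_trans _ (p :: t ++ s)).
  by apply: (@tensor_cat [:: p] [:: p]); [exact: tensor_refl | exact: IH].
rewrite -cat_rcons -cat_cons; apply: tensor_cat; first exact: H.
exact: tensor_refl.
Qed.

End Tensor.

Section TensorMap.
Variables M N M' N' : bimodType B.

(* f (x) g; meaningful when f and g are B-linear. *)
Definition tmap (f : M -> M') (g : N -> N') (t : tensor M N) : tensor M' N' :=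
  tsum [seq (f p.1, g p.2) | p <- repr t].

Definition balanced (f : M -> M') (g : N -> N') : Prop :=
  [/\ forall x x', f (x + x') = f x + f x',
      forall y y', g (y + y') = g y + g y' &
      forall x b y, tens (f (ract x b)) (g y) = tens (f x) (g (lact b y))].

Lemma tmap_tsum f g s : balanced f g ->
  tmap f g (tsum s) = tsum [seq (f p.1, g p.2) | p <- s].
Proof.
case=> fD gD fg; apply/tsumP; have := repr_tsum s.
move: (repr _) => t; elim=> {s t} //=.
- by move=> s; exact: tensor_refl.
- by move=> s t _; exact: tensor_sym.
- by move=> s t u _ st _; exact: tensor_trans.
- by move=> s s' t t' _ ss' _ tt'; rewrite !map_cat; exact: tensor_cat.
- by move=> p q; exact: tensor_swap.
- move=> y; have -> : f 0 = 0 by apply: (addIr (f 0)); rewrite -fD !add0r.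
  exact: tensor_zero.
- by move=> x x' y; rewrite fD; exact: tensor_addl.
- by move=> x y y'; rewrite gD; exact: tensor_addr.
- by move=> x b y; apply/tsumP; exact: fg.
Qed.

End TensorMap.

Section TensorBimodule.
Variables M N : bimodType B.
Implicit Types (t u v : tensor M N).

Lemma tens_bal (x : M) b (y : N) : tens (ract x b) y = tens x (lact b y).
Proof. by apply/tsumP; exact: tensor_bal. Qed.

Let tzero : tensor M N := tsum [::].
Let tadd t u : tensor M N := tsum (repr t ++ repr u).
Let topp t := tmap -%R id t.
Let tscale (k : K) t := tmap ( *:%R k) id t.
Let tlact (a : B) t := tmap (lact a) id t.
Let tract t (b : B) := tmap id (ract^~ b) t.

Let taddE s s' : tadd (tsum s) (tsum s') = tsum (s ++ s').
Proof. by apply/tsumP; apply: tensor_cat; exact: repr_tsum. Qed.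

Fact taddA : associative tadd.
Proof.
move=> t u v; rewrite -(tsum_repr t) -(tsum_repr u) -(tsum_repr v).
by rewrite !taddE catA.
Qed.
Fact taddC : commutative tadd.
Proof. by move=> t u; apply/tsumP; exact: tensor_catC. Qed.
Fact tadd0 : left_id tzero tadd.
Proof. by move=> t; rewrite -(tsum_repr t) taddE. Qed.

Fact balanced_opp : balanced (-%R : M -> M) (id : N -> N).
Proof. by split=> // [x x'|x b y]; rewrite ?opprD// -ractN tens_bal. Qed.
Fact balanced_scale k : balanced ( *:%R k : M -> M) (id : N -> N).
Proof. by split=> // [x x'|x b y]; rewrite ?scalerDr// -ractZl tens_bal. Qed.
Fact balanced_lact a : balanced (lact a : M -> M) (id : N -> N).
Proof. by split=> // [x x'|x b y]; rewrite ?lactDr// -lract tens_bal. Qed.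
Fact balanced_ract b : balanced (id : M -> M) (ract^~ b : N -> N).
Proof. by split=> // [y y'|x c y]; rewrite ?ractDl// lract tens_bal. Qed.

Let toppE s : topp (tsum s) = tsum [seq (- p.1, p.2) | p <- s].
Proof. exact: tmap_tsum balanced_opp. Qed.
Let tscaleE k s : tscale k (tsum s) = tsum [seq (k *: p.1, p.2) | p <- s].
Proof. exact: tmap_tsum (balanced_scale k). Qed.
Let tlactE a s : tlact a (tsum s) = tsum [seq (lact a p.1, p.2) | p <- s].
Proof. exact: tmap_tsum (balanced_lact a). Qed.
Let tractE s b : tract (tsum s) b = tsum [seq (p.1, ract p.2 b) | p <- s].
Proof. exact: tmap_tsum (balanced_ract b). Qed.

Fact taddN : left_inverse tzero topp tadd.
Proof.
move=> t; rewrite -(tsum_repr t) toppE taddE; move: (repr t) => s {t}.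
elim: s => [//|[x y] s IH] /=.
pose u : tensor M N := tsum [seq (- p.1, p.2) | p <- s].
pose v : tensor M N := tsum s.
pose a : tensor M N := tsum [:: (- x, y)].
pose b : tensor M N := tsum [:: (x, y)].
transitivity (tadd (tadd a u) (tadd b v)); first by rewrite /a /b /u /v !taddE.
rewrite -taddA [tadd u _]taddC -[tadd _ u]taddA [tadd v u]taddC /u /v taddE IH.
rewrite [tadd b _]taddC tadd0 /a /b taddE.
apply/(tsumP _ [::]); apply: (tensor_trans _ (tensor_zero M y)).
by apply: tensor_sym; rewrite -(addNr x); exact: tensor_addl.
Qed.

HB.instance Definition _ :=
  GRing.isZmodule.Build (tensor M N) taddA taddC tadd0 taddN.

Lemma tsum_cat s s' : tsum (s ++ s') = tsum s + tsum s' :> tensor M N.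
Proof. exact: esym (taddE s s'). Qed.
Lemma tsum_nil : tsum [::] = 0 :> tensor M N.
Proof. by []. Qed.
Lemma tsumE s : tsum s = \sum_(p <- s) tens p.1 p.2 :> tensor M N.
Proof.
elim: s => [|[x y] s IH]; first by rewrite big_nil.
by rewrite big_cons -IH -[in LHS]cat1s tsum_cat.
Qed.
Lemma tensE t : t = \sum_(p <- repr t) tens p.1 p.2.
Proof. by rewrite -tsumE tsum_repr. Qed.
Lemma tensDl (x x' : M) (y : N) : tens (x + x') y = tens x y + tens x' y.
Proof. by rewrite -tsum_cat; apply/tsumP; exact: tensor_addl. Qed.
Lemma tensDr (x : M) (y y' : N) : tens x (y + y') = tens x y + tens x y'.
Proof. by rewrite -tsum_cat; apply/tsumP; exact: tensor_addr. Qed.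

Let tsum_map_add (f g h : M * N -> M * N) s :
  (forall p, tsum [:: f p] = tsum [:: g p] + tsum [:: h p] :> tensor M N) ->
  tsum (map f s) = tsum (map g s) + tsum (map h s) :> tensor M N.
Proof.
move=> fgh; rewrite !tsumE !big_map -big_split; apply: eq_bigr => p _.
by have := fgh p; rewrite !tsumE !big_seq1.
Qed.

Fact tscaleA k l t : tscale k (tscale l t) = tscale (k * l) t.
Proof.
rewrite -(tsum_repr t) !tscaleE -map_comp; congr tsum; apply: eq_map => p /=.
by rewrite scalerA.
Qed.
Fact tscale1 : left_id 1 tscale.
Proof.
move=> t; rewrite -(tsum_repr t) tscaleE; congr tsum; rewrite -[RHS]map_id.
by apply: eq_map => -[x y] /=; rewrite scale1r.
Qed.
Fact tscaleDr : right_distributive tscale +%R.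
Proof.
move=> k t u; rewrite -(tsum_repr t) -(tsum_repr u) -tsum_cat !tscaleE.
by rewrite map_cat tsum_cat.
Qed.
Fact tscaleDl t : {morph tscale^~ t : k l / k + l}.
Proof.
move=> k l; rewrite -(tsum_repr t) !tscaleE; apply: tsum_map_add => p /=.
by rewrite scalerDl; exact: tensDl.
Qed.

HB.instance Definition _ := GRing.Zmodule_isLmodule.Build K (tensor M N)
  tscaleA tscale1 tscaleDr tscaleDl.

Fact tlactDl a b t : tlact (a + b) t = tlact a t + tlact b t.
Proof.
rewrite -(tsum_repr t) !tlactE; apply: tsum_map_add => p /=.
by rewrite lactDl; exact: tensDl.
Qed.
Fact tlactDr a t u : tlact a (t + u) = tlact a t + tlact a u.
Proof.
by rewrite -(tsum_repr t) -(tsum_repr u) -tsum_cat !tlactE map_cat tsum_cat.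
Qed.
Fact tlactM a b t : tlact (a * b) t = tlact a (tlact b t).
Proof.
rewrite -(tsum_repr t) !tlactE -map_comp; congr tsum; apply: eq_map => p /=.
by rewrite lactM.
Qed.
Fact tlact1 t : tlact 1 t = t.
Proof.
rewrite -[in RHS](tsum_repr t) -(tsum_repr t) tlactE tsum_repr; congr tsum.
by rewrite -[RHS]map_id; apply: eq_map => -[x y] /=; rewrite lact1.
Qed.
Fact tlactZ k a t : tlact (k *: a) t = k *: tlact a t.
Proof.
rewrite -(tsum_repr t) !tlactE [RHS]tscaleE -map_comp; congr tsum.
by apply: eq_map => p /=; rewrite lactZ.
Qed.
Fact tractDl t u b : tract (t + u) b = tract t b + tract u b.
Proof.
by rewrite -(tsum_repr t) -(tsum_repr u) -tsum_cat !tractE map_cat tsum_cat.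
Qed.
Fact tractDr t a b : tract t (a + b) = tract t a + tract t b.
Proof.
rewrite -(tsum_repr t) !tractE; apply: tsum_map_add => p /=.
by rewrite ractDr; exact: tensDr.
Qed.
Fact tractM t a b : tract t (a * b) = tract (tract t a) b.
Proof.
rewrite -(tsum_repr t) !tractE -map_comp; congr tsum; apply: eq_map => p /=.
by rewrite ractM.
Qed.
Fact tract1 t : tract t 1 = t.
Proof.
rewrite -[in RHS](tsum_repr t) -(tsum_repr t) tractE tsum_repr; congr tsum.
by rewrite -[RHS]map_id; apply: eq_map => -[x y] /=; rewrite ract1.
Qed.
Lemma tens_scale k (x : M) (y : N) : tens (k *: x) y = tens x (k *: y).
Proof. by rewrite -ract_scale tens_bal lact_scale. Qed.
Fact tractZ k a t : tract t (k *: a) = k *: tract t a.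
Proof.
rewrite -(tsum_repr t) !tractE [RHS]tscaleE -map_comp !tsumE !big_map.
by apply: eq_bigr => p _ /=; rewrite ractZ tens_scale.
Qed.
Fact tlract a t b : tract (tlact a t) b = tlact a (tract t b).
Proof. by rewrite -(tsum_repr t) [tlact a (tsum _)]tlactE [tract (tsum (repr t)) b]tractE [LHS]tractE [RHS]tlactE -!map_comp. Qed.

HB.instance Definition _ := isBimodule.Build K B (tensor M N)
  tlactDl tlactDr tlactM tlact1 tlactZ tractDl tractDr tractM tract1 tractZ
  tlract.

Lemma lact_tens a (x : M) (y : N) : lact a (tens x y) = tens (lact a x) y.
Proof. exact: tlactE. Qed.
Lemma ract_tens a (x : M) (y : N) : ract (tens x y) a = tens x (ract y a).
Proof. exact: tractE. Qed.

Lemma tensor_ind_tens (P : tensor M N -> Prop) :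
  P 0 -> (forall t u, P t -> P u -> P (t + u)) ->
  (forall x y, P (tens x y)) -> forall t, P t.
Proof.
move=> P0 PD Pt t; rewrite (tensE t).
by elim/big_ind: _ => // *; exact: PD.
Qed.


End TensorBimodule.

Section TensorLift.
Variables (M N : bimodType B) (G : zmodType).

(* The additive map on M (x)_B N sending x (x) y to f x y; meaningful when f  *)
(* is biadditive and f (x b) y = f x (b y).                                   *)
Definition tlift (f : M -> N -> G) (t : tensor M N) : G :=
  \sum_(p <- repr t) f p.1 p.2.

Definition bilinear_balanced (f : M -> N -> G) : Prop :=
  [/\ forall x x' y, f (x + x') y = f x y + f x' y,
      forall x y y', f x (y + y') = f x y + f x y' &
      forall x b y, f (ract x b) y = f x (lact b y)].

Lemma tlift_tsum f s : bilinear_balanced f ->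
  tlift f (tsum s) = \sum_(p <- s) f p.1 p.2.
Proof.
case=> fDl fDr fb; have := repr_tsum s.
rewrite /tlift; move: (repr _) => t; elim=> {s t} //=.
- by move=> s t u _ -> _ ->.
- by move=> s s' t t' _ ss' _ tt'; rewrite !big_cat /= ss' tt'.
- by move=> p q; rewrite !big_cons !big_nil !addr0 addrC.
- move=> y; rewrite big_seq1 big_nil /=.
  by apply: (addIr (f 0 y)); rewrite -fDl !add0r.
- by move=> x x' y; rewrite !big_cons !big_nil !addr0 fDl.
- by move=> x y y'; rewrite !big_cons !big_nil !addr0 fDr.
- by move=> x b y; rewrite !big_seq1 fb.
Qed.

Lemma tlift_tens f x y : bilinear_balanced f -> tlift f (tens x y) = f x y.
Proof. by move=> fb; rewrite tlift_tsum// big_seq1. Qed.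

Lemma tliftD f : bilinear_balanced f ->
  {morph tlift f : t u / t + u}.
Proof.
move=> fb t u; rewrite -(tsum_repr t) -(tsum_repr u) -tsum_cat !tlift_tsum//.
by rewrite big_cat.
Qed.

Lemma tlift0 f : bilinear_balanced f -> tlift f 0 = 0.
Proof.
by move=> fb; apply: (addIr (tlift f 0)); rewrite -(tliftD fb) !add0r.
Qed.

End TensorLift.

(* Algebraic direct sums: families of finite support. *)
Section DirectSum.
Variables (J : choiceType) (F : J -> bimodType B).

Record dsum : Type := DSum {
  dsum_fun :> forall j, F j;
  dsum_fin : finite_set [set j | dsum_fun j != 0] }.

HB.instance Definition _ := gen_eqMixin dsum.
HB.instance Definition _ := gen_choiceMixin dsum.

Lemma dsumP (x y : dsum) : (forall j, x j = y j) -> x = y.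
Proof.
case: x y => [x xP] [y yP] /= xy.
have {}xy : x = y by apply: functional_extensionality_dep.
by case: _ / xy yP => yP; congr DSum; exact: Prop_irrelevance.
Qed.

Fact dsum_fin0 : finite_set [set j | (0 : F j) != 0].
Proof.
by apply: (sub_finite_set _ (@finite_set0 J)) => j /=; rewrite eqxx.
Qed.
Fact dsum_fin_map (f : forall j, F j -> F j) (x : dsum) :
  (forall j, f j 0 = 0) -> finite_set [set j | f j (x j) != 0].
Proof.
move=> f0; apply: sub_finite_set (dsum_fin x) => j /=.
by apply: contraNN => /eqP ->; rewrite f0.
Qed.
Fact dsum_finD (x y : dsum) : finite_set [set j | x j + y j != 0].
Proof.
have := dsum_fin y; have := dsum_fin x; rewrite -[_ -> _ -> _]/(_ -> _).
move=> fx fy; apply: (sub_finite_set (B := _ `|` _)); last first.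
  by rewrite finite_setU; split; [exact: fx | exact: fy].
move=> j /=; have [->|] := eqVneq (x j) 0; last by left.
by rewrite add0r; right.
Qed.

Let dmap f f0 (x : dsum) := DSum (@dsum_fin_map f x f0).
Let dzero := DSum dsum_fin0.
Let dadd (x y : dsum) := DSum (dsum_finD x y).
Let dopp := dmap (f := fun j => -%R) (fun j => oppr0 _).
Let dscale (k : K) := dmap (f := fun j => *:%R k) (fun j => scaler0 _ k).
Let dlact a := dmap (f := fun j => lact a) (fun j => lact0 _ a).
Let dract x b := dmap (f := fun j => ract^~ b) (fun j => ract0 _ b) x.

Fact daddA : associative dadd.
Proof. by move=> x y z; apply: dsumP => j; exact: addrA. Qed.
Fact daddC : commutative dadd.
Proof. by move=> x y; apply: dsumP => j; exact: addrC. Qed.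
Fact dadd0 : left_id dzero dadd.
Proof. by move=> x; apply: dsumP => j; exact: add0r. Qed.
Fact daddN : left_inverse dzero dopp dadd.
Proof. by move=> x; apply: dsumP => j; exact: addNr. Qed.
HB.instance Definition _ := GRing.isZmodule.Build dsum daddA daddC dadd0 daddN.

Fact dscaleA k l x : dscale k (dscale l x) = dscale (k * l) x.
Proof. by apply: dsumP => j; exact: scalerA. Qed.
Fact dscale1 : left_id 1 dscale.
Proof. by move=> x; apply: dsumP => j; exact: scale1r. Qed.
Fact dscaleDr : right_distributive dscale +%R.
Proof. by move=> k x y; apply: dsumP => j; exact: scalerDr. Qed.
Fact dscaleDl x : {morph dscale^~ x : k l / k + l}.
Proof. by move=> k l; apply: dsumP => j; exact: scalerDl. Qed.
HB.instance Definition _ := GRing.Zmodule_isLmodule.Build K dsum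
  dscaleA dscale1 dscaleDr dscaleDl.

Fact dlactDl a b x : dlact (a + b) x = dlact a x + dlact b x.
Proof. by apply: dsumP => j; exact: lactDl. Qed.
Fact dlactDr a x y : dlact a (x + y) = dlact a x + dlact a y.
Proof. by apply: dsumP => j; exact: lactDr. Qed.
Fact dlactM a b x : dlact (a * b) x = dlact a (dlact b x).
Proof. by apply: dsumP => j; exact: lactM. Qed.
Fact dlact1 x : dlact 1 x = x.
Proof. by apply: dsumP => j; exact: lact1. Qed.
Fact dlactZ k a x : dlact (k *: a) x = k *: dlact a x.
Proof. by apply: dsumP => j; exact: lactZ. Qed.
Fact dractDl x y b : dract (x + y) b = dract x b + dract y b.
Proof. by apply: dsumP => j; exact: ractDl. Qed.
Fact dractDr x a b : dract x (a + b) = dract x a + dract x b.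
Proof. by apply: dsumP => j; exact: ractDr. Qed.
Fact dractM x a b : dract x (a * b) = dract (dract x a) b.
Proof. by apply: dsumP => j; exact: ractM. Qed.
Fact dract1 x : dract x 1 = x.
Proof. by apply: dsumP => j; exact: ract1. Qed.
Fact dractZ k a x : dract x (k *: a) = k *: dract x a.
Proof. by apply: dsumP => j; exact: ractZ. Qed.
Fact dlract a x b : dract (dlact a x) b = dlact a (dract x b).
Proof. by apply: dsumP => j; exact: lract. Qed.
HB.instance Definition _ := isBimodule.Build K B dsum
  dlactDl dlactDr dlactM dlact1 dlactZ dractDl dractDr dractM dract1 dractZ
  dlract.

Fact dinj_fin (j : J) (x : F j) :
  finite_set [set k | @dfwith J F (fun=> 0) j x k != 0].
Proof.
apply: (sub_finite_set _ (finite_set1 j)) => k /=.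
by have [jk|jk] := eqVneq j k; [case: k / jk | rewrite dfwith_out// eqxx].
Qed.
Definition dinj (j : J) (x : F j) : dsum := DSum (dinj_fin x).

Lemma dinj_in j (x : F j) : dinj x j = x.
Proof. exact: dfwith_in. Qed.
Lemma dinj_out j (x : F j) k : j != k -> dinj x k = 0.
Proof. exact: dfwith_out. Qed.


Lemma dsumD (x y : dsum) j : (x + y) j = x j + y j.
Proof. by []. Qed.
Lemma dsum0 j : (0 : dsum) j = 0.
Proof. by []. Qed.

Lemma dinjD j (x y : F j) : dinj (x + y) = dinj x + dinj y.
Proof.
apply: dsumP => k; rewrite dsumD; have [jk|jk] := eqVneq j k.
  by case: k / jk; rewrite !dinj_in.
by rewrite !dinj_out// addr0.
Qed.

Lemma lact_dinj a j (x : F j) : lact a (dinj x) = dinj (lact a x).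
Proof.
apply: dsumP => k; have -> (y : dsum) : (lact a y : dsum) k = lact a (y k) by [].
have [jk|jk] := eqVneq j k; last by rewrite !dinj_out// lact0.
by case: k / jk; rewrite !dinj_in.
Qed.
Lemma ract_dinj a j (x : F j) : ract (dinj x) a = dinj (ract x a).
Proof.
apply: dsumP => k; have -> (y : dsum) : (ract y a : dsum) k = ract (y k) a by [].
have [jk|jk] := eqVneq j k; last by rewrite !dinj_out// ract0.
by case: k / jk; rewrite !dinj_in.
Qed.

Section Lift.
Variables (G : zmodType) (f : forall j, F j -> G).

(* The additive map on the direct sum with components f j. *)
Definition dlift (x : dsum) : G := \sum_(j \in [set: J]) f (x j).

Hypothesis fD : forall j, {morph @f j : x y / x + y}.

Let f0 j : f (0 : F j) = 0.
Proof. by apply: (addIr (f (0 : F j))); rewrite -fD !add0r. Qed.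

Let f_fin (x : dsum) : finite_set [set j | f (x j) != 0].
Proof.
apply: sub_finite_set (dsum_fin x) => j /=.
by apply: contraNN => /eqP ->; rewrite f0.
Qed.

Let dlift_supp (S : set J) (x : dsum) : (forall j, x j != 0 -> S j) ->
  dlift x = \sum_(j \in S) f (x j).
Proof.
move=> xS; apply/esym/fsbig_widen => // j [_ /= jS]; apply/eqP.
have [->|/xS//] := eqVneq (x j) 0; by rewrite f0.
Qed.

Lemma dliftD : {morph dlift : x y / x + y}.
Proof.
move=> x y; pose S := [set j | x j != 0] `|` [set j | y j != 0].
have Sfin : finite_set S by rewrite finite_setU; split; exact: dsum_fin.
rewrite !(@dlift_supp S).
- by rewrite -fsbig_split//; apply: eq_fsbigr => j _; rewrite dsumD fD.
- by move=> j yj; right.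
- by move=> j xj; left.
- move=> j; rewrite dsumD; have [->|xj _] := eqVneq (x j) 0; last by left.
  by rewrite add0r; right.
Qed.

Lemma dlift_dinj j (x : F j) : dlift (dinj x) = f x.
Proof.
rewrite (@dlift_supp [set j]) ?fsbig_set1 ?dinj_in// => k.
by have [jk|jk] := eqVneq j k; [case: k / jk | rewrite dinj_out// eqxx].
Qed.

End Lift.

Lemma dsum_eq_lift (x : dsum) : x = dlift dinj x.
Proof.
apply: dsumP => k.
have evD : {morph (fun y : dsum => y k) : y z / y + z} by [].
rewrite /dlift fsbig_supp; set A := _ `&` _.
have finA : finite_set A.
  apply: sub_finite_set (dsum_fin x) => j [_] /=.
  move=> nz; apply/eqP => xj; apply: nz; rewrite xj; apply: dsumP => l.
  have [jl|jl] := eqVneq j l; last by rewrite dinj_out.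
  by case: l / jl; rewrite dinj_in.
rewrite (fsbig_finite _ _ finA).
rewrite (big_morph (fun y : dsum => y k) evD (dsum0 k)).
have [kA|kA] := boolP (k \in A).
  rewrite (bigD1_seq k) ?fset_uniq ?in_fset_set// dinj_in big1.
    by rewrite [RHS]addr0.
  by move=> j jk; rewrite dinj_out.
rewrite big1_seq => [|j /andP[_]]; last first.
  rewrite in_fset_set// => jA; rewrite dinj_out//.
  by apply: contraNneq kA => <-.
apply/eqP; apply: contraNT kA => /eqP xk; rewrite inE; split=> //= x0.
by apply: xk; rewrite -(dinj_in (x k)) x0.
Qed.

Lemma dsum_ind_inj (P : dsum -> Prop) :
  P 0 -> (forall x y, P x -> P y -> P (x + y)) ->
  (forall j (x : F j), P (dinj x)) -> forall x, P x.
Proof.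
move=> P0 PD Pi x; rewrite (dsum_eq_lift x) /dlift.
by elim/big_ind: _ => // *; exact: PD.
Qed.

End DirectSum.

End BimoduleTheory.

Section MonotonicProduct.
Variables (R : realType) (B : cstarAlgType R) (I : set int).
Variable E : I -> semiInnerBimodType B.

Definition ltI (i j : I) : bool := (val i < val j)%R.
Definition gtI (i j : I) : bool := ltI j i.

(* The summand E_(i_1) (x) ... (x) E_(i_n) of the word i_1 ... i_n; the       *)
(* summand B of the monotonic product is that of the empty word.              *)
Fixpoint word_mod (w : seq I) : bimodType B :=
  match w with
  | [::] => regular_bimod B
  | i :: w' => match w' with
               | [::] => E i
               | _ :: _ => tensor (E i) (word_mod w')
               end
  end.

(* e (x) x as an element of the summand of i :: w, where E_i (x)_B B = E_i    *)
(* when w is empty.                                                           *)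
Definition tcons (i : I) (w : seq I) :
    E i -> word_mod w -> word_mod (i :: w) :=
  match w with
  | [::] => fun e c => ract e c
  | _ :: _ => fun e x => tens e x
  end.

(* The pairing <f_n, <f_(n-1), ... <f_1, e_1> ... e_(n-1)> e_n>.  It does not *)
(* depend on how the right argument is written as a sum of elementary         *)
(* tensors; for the left argument this requires <b x, y> = <x, b^* y> in the  *)
(* E_i (see word_ip_tcons), and a fixed representative is used otherwise.     *)
Fixpoint word_ip (w : seq I) : word_mod w -> word_mod w -> B :=
  match w with
  | [::] => fun a b : B => star a * b
  | i :: w' =>
    match w' return (word_mod w' -> word_mod w' -> B) ->
                    word_mod (i :: w') -> word_mod (i :: w') -> B with
    | [::] => fun _ e f => ip e f
    | _ :: _ => fun wip t u =>
        \sum_(f <- repr t) \sum_(e <- repr u)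
          wip f.2 (lact (ip f.1 e.1) e.2)
    end (@word_ip w')
  end.

Section WordIp.
Hypothesis adj : forall i (b : B) (x y : E i),
  ip (lact b x) y = ip x (lact (star b) y).

Let ipDr i (x y z : E i) : ip x (y + z) = ip x y + ip x z.
Proof. by have := ip_linear x y z 1 1; rewrite !scale1r. Qed.
Let ipDl i (x y z : E i) : ip (x + y) z = ip x z + ip y z.
Proof. by rewrite !(ip_star z) ipDr starD. Qed.
Let ip_ractl i (x y : E i) b : ip (ract x b) y = star b * ip x y.
Proof. by rewrite ip_star ip_ract starM -ip_star. Qed.

Let spec w := [/\ forall x y z : word_mod w,
    word_ip x (y + z) = word_ip x y + word_ip x z,
  forall x y z : word_mod w, word_ip (x + y) z = word_ip x z + word_ip y z &
  forall b (x y : word_mod w),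
    word_ip (lact b x) y = word_ip x (lact (star b) y)].

Let wip i w (f : E i) (x : word_mod w) (e : E i) (y : word_mod w) : B :=
  word_ip x (lact (ip f e) y).

Let wip_balanced i w f x : spec w -> bilinear_balanced (@wip i w f x).
Proof.
case=> Dr Dl wadj; rewrite /wip; split=> [e e' y|e y y'|e b y].
- by rewrite ipDr lactDl Dr.
- by rewrite lactDr Dr.
- by rewrite ip_ract lactM.
Qed.

Let wip_balanced2 i w u : spec w ->
  bilinear_balanced (fun (f : E i) (x : word_mod w) => tlift (wip f x) u).
Proof.
case=> Dr Dl wadj; rewrite /tlift /wip.
split=> [f f' x|f x x'|f b x]; rewrite -?big_split; apply: eq_bigr => p _ /=.
- by rewrite ipDl lactDl Dr.
- by rewrite Dl.
- by rewrite ip_ractl lactM wadj.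
Qed.

Let wip2 i w (t u : tensor (E i) (word_mod w)) : B :=
  tlift (fun f x => tlift (wip f x) u) t.

Let wip2Dr i w (t u v : tensor (E i) (word_mod w)) : spec w ->
  wip2 t (u + v) = wip2 t u + wip2 t v.
Proof.
move=> sw; transitivity (\sum_(p <- repr t)
  (tlift (wip p.1 p.2) u + tlift (wip p.1 p.2) v)); last exact: big_split.
by apply: eq_bigr => p _; apply: tliftD; exact: wip_balanced.
Qed.

Let wip2_adj i w b (t u : tensor (E i) (word_mod w)) : spec w ->
  wip2 (lact b t) u = wip2 t (lact (star b) u).
Proof.
move=> sw; have b2 := @wip_balanced2 i w ^~ sw.
have b1 f x := @wip_balanced i w f x sw.
rewrite /wip2; elim/tensor_ind_tens: t => [|t t' IHt IHt'|f x].
- by rewrite lact0 !tlift0.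
- by rewrite lactDr !tliftD// IHt IHt'.
- rewrite lact_tens !tlift_tens//.
  elim/tensor_ind_tens: u => [|u u' IHu IHu'|e y].
  + by rewrite lact0 !tlift0.
  + by rewrite lactDr !tliftD// IHu IHu'.
  + by rewrite lact_tens !tlift_tens// /wip adj.
Qed.

Let word_specP w : spec w.
Proof.
elim: w => [|i [|j w] IH].
- split=> [x y z|x y z|b x y].
  + exact: mulrDr.
  + by rewrite /= -mulrDl -starD.
  + have -> : @word_ip [::] (lact b x) y = star x * star b * y :> B.
      by congr (_ * _); exact: starM.
    exact: esym (mulrA _ _ _).
- by split=> [x y z|x y z|b x y] /=; rewrite ?ipDr ?ipDl ?adj.
- split=> [t u v|t u v|b t u].
  + exact: (@wip2Dr i (j :: w)).
  + exact: (tliftD (@wip_balanced2 i (j :: w) v IH)).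
  + exact: (@wip2_adj i (j :: w)).
Qed.

(* The inductive form of the defining formula                                 *)
(* <e (x) x, f (x) y> = <x, <e, f> y> of the pairing.                         *)
Lemma word_ip_tcons i w (e f : E i) (x y : word_mod w) :
  word_ip (tcons e x) (tcons f y) = word_ip x (lact (ip e f) y).
Proof.
case: w x y => [|j w] x y.
  by rewrite /= ip_ract ip_ractl mulrA.
have sw := word_specP (j :: w).
rewrite -[LHS]/(wip2 (tens e x) (tens f y)) /wip2 tlift_tens; last exact: wip_balanced2.
by rewrite tlift_tens//; exact: wip_balanced.
Qed.

End WordIp.

Definition word : Type := {w : seq I | sorted gtI w}.
Definition word_lt (i : I) : Type := {w : seq I | path gtI i w}.
Definition word_gt (i : I) : Type :=
  {w : seq I | sorted gtI w && (if w is j :: _ then ltI i j else false)}.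

Definition mprod : bimodType B := dsum (fun w : word => word_mod (val w)).
Definition winj (w : word) (x : word_mod (val w)) : mprod :=
  @dinj _ _ _ (fun w : word => word_mod (val w)) w x.
(* B (+) E^m_(<i) *)
Definition mprod_lt (i : I) : bimodType B :=
  dsum (fun w : word_lt i => word_mod (val w)).
(* E^m_(>i) *)
Definition mprod_gt (i : I) : bimodType B :=
  dsum (fun w : word_gt i => word_mod (val w)).

(* Distinct summands are orthogonal; summing over the support of x keeps a     *)
(* zero component of x from contributing even when the pairing is not well    *)
(* defined on its left argument (see word_ip).                                *)
Definition mprod_ip (x y : mprod) : B :=
  \sum_(w \in [set w | x w != 0]) word_ip (x w) (y w).

Definition word_nil : word := exist _ [::] isT.
Definition mprod1 : mprod := @winj word_nil (1 : B).

Definition word_of_lt (i : I) (w : word_lt i) : word :=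
  exist _ (val w) (path_sorted (valP w)).
Definition word_cons (i : I) (w : word_lt i) : word :=
  exist _ (i :: val w) (valP w).
Definition word_of_gt (i : I) (w : word_gt i) : word :=
  exist _ (val w) (proj1 (andP (valP w))).

Definition BE (i : I) : bimodType B := (regular_bimod B * E i)%type.

(* (b, e) (x) x |-> b x + e (x) x *)
Definition ident_lt (i : I) (u : BE i) (x : mprod_lt i) : mprod :=
  dlift (fun w (y : word_mod (val w)) =>
    @winj (word_of_lt w) (lact u.1 y) + @winj (word_cons w) (tcons u.2 y)) x.

Definition ident_gt (i : I) (x : mprod_gt i) : mprod :=
  dlift (fun w (y : word_mod (val w)) =>
    @winj (word_of_gt w) y) x.

(* The identification of                                                      *)
(* ((B (+) E_i) (x)_B (B (+) E^m_(<i))) (+) E^m_(>i) with E^m.                *)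
Definition ident (i : I) (p : tensor (BE i) (mprod_lt i) * mprod_gt i) :
    mprod :=
  tlift (@ident_lt i) p.1 + ident_gt p.2.

Lemma tcons_balanced i w : bilinear_balanced (@tcons i w).
Proof.
case: w => [|j w]; split=> /=.
- exact: ractDl.
- exact: ractDr.
- by move=> e b c; rewrite -ractM.
- exact: tensDl.
- exact: tensDr.
- exact: tens_bal.
Qed.

Lemma tcons0 i w (y : word_mod w) : tcons (0 : E i) y = 0.
Proof.
have [tD _ _] := tcons_balanced i w.
by apply: (addIr (tcons 0 y)); rewrite -tD !add0r.
Qed.

Lemma winjD (w : word) : {morph @winj w : x y / x + y}.
Proof. move=> x y; exact: (dinjD (F := fun w : word => word_mod (val w)) x y). Qed.

Let ident_lt_summandD i (u : BE i) (w : word_lt i) :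
  {morph (fun y : word_mod (val w) =>
    @winj (word_of_lt w) (lact u.1 y) + @winj (word_cons w) (tcons u.2 y))
  : y z / y + z}.
Proof.
have [_ tD _] := tcons_balanced i (val w).
by move=> y z; rewrite lactDr tD !winjD addrACA.
Qed.

Lemma ident_lt_winj i (u : BE i) (w : word_lt i) (y : word_mod (val w)) :
  ident_lt u (@dinj _ _ _ (fun w : word_lt i => word_mod (val w)) w y) =
  @winj (word_of_lt w) (lact u.1 y) + @winj (word_cons w) (tcons u.2 y).
Proof. by rewrite /ident_lt dlift_dinj//; exact: ident_lt_summandD. Qed.

Lemma ident_lt_balanced i : bilinear_balanced (@ident_lt i).
Proof.
have lD u : {morph @ident_lt i u : y z / y + z}.
  by apply: dliftD; exact: ident_lt_summandD.
have l0 u : @ident_lt i u 0 = 0.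
  by apply: (addIr (ident_lt u 0)); rewrite -lD !add0r.
split=> //.
- move=> u u'; elim/dsum_ind_inj => [|x y IHx IHy|w y].
  + by rewrite !l0 addr0.
  + by rewrite !lD IHx IHy addrACA.
  + have [tD _ _] := tcons_balanced i (val w).
    by rewrite !ident_lt_winj lactDl tD !winjD addrACA.
- move=> u b; elim/dsum_ind_inj => [|x y IHx IHy|w y].
  + by rewrite lact0 !l0.
  + by rewrite lactDr !lD IHx IHy.
  + have [_ _ tb] := tcons_balanced i (val w).
    by rewrite lact_dinj !ident_lt_winj /= tb lactM.
Qed.

Lemma ident_gtD i : {morph @ident_gt i : x y / x + y}.
Proof. by apply: dliftD => w y z; exact: (@winjD (word_of_gt w)). Qed.

Lemma ident_gt_winj i (w : word_gt i) (y : word_mod (val w)) :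
  ident_gt (@dinj _ _ _ (fun w : word_gt i => word_mod (val w)) w y) =
  @winj (word_of_gt w) y.
Proof. by rewrite /ident_gt dlift_dinj// => v x z; exact: (@winjD (word_of_gt v)). Qed.

Lemma identD i : {morph @ident i : p q / p + q}.
Proof.
move=> p q; rewrite /ident /= tliftD; last exact: ident_lt_balanced.
by rewrite ident_gtD addrACA.
Qed.

Local Notation iT i := (tensor (BE i) (mprod_lt i) * mprod_gt i)%type.
Local Notation ldinj w y :=
  (@dinj _ _ _ (fun w0 : word_lt _ => word_mod (val w0)) w y).
Local Notation gdinj w y :=
  (@dinj _ _ _ (fun w0 : word_gt _ => word_mod (val w0)) w y).

Let be i (b : B) (e : E i) : BE i := (b, e).

Let ident_summand_inv i (w : seq I) : exists phi : word_mod w -> iT i,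
  [/\ {morph phi : y z / y + z},
      forall (pw : path gtI i w) y,
        phi y = (tens (be (1 : B) 0) (ldinj (exist _ w pw) y), 0),
      forall (pw : sorted gtI w && (if w is j :: _ then ltI i j else false)) y,
        phi y = (0, gdinj (exist _ w pw) y) &
      forall w' (pw' : path gtI i w') (h : i :: w' = w) (e : E i) y,
        phi (ecast w (word_mod w) h (tcons e y)) =
        (tens (be (0 : B) e) (ldinj (exist _ w' pw') y), 0)].
Proof.
have gt0 j : ~~ ltI j j by rewrite /ltI ltxx.
have [pw|/negP npw] := pselect (path gtI i w).
  have ngt : ~~ (sorted gtI w && (if w is j :: _ then ltI i j else false)).
    case: w pw => //= j w /andP[ji _]; rewrite negb_and; apply/orP; right.
    by move: ji; rewrite /gtI /ltI -leNgt => /ltW.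
  exists (fun y => (tens (be (1 : B) 0) (ldinj (exist _ w pw) y), 0)); split.
  - by move=> y z; rewrite dinjD tensDr; congr pair; rewrite addr0.
  - by move=> pw' y; rewrite (bool_irrelevance pw' pw).
  - by move=> pw'; move: ngt; rewrite pw'.
  - by move=> w' pw' h; exfalso; move: pw; rewrite -h /= {1}/gtI (negPf (gt0 i)).
have [gw|/negP ngw] :=
    pselect (sorted gtI w && (if w is j :: _ then ltI i j else false)).
  exists (fun y => (0, gdinj (exist _ w gw) y)); split.
  - by move=> y z; rewrite dinjD; congr pair; rewrite addr0.
  - by move=> pw'; move: npw; rewrite pw'.
  - by move=> pw' y; rewrite (bool_irrelevance pw' gw).
  - by move=> w' pw' h; exfalso; move: gw; rewrite -h /= (negPf (gt0 i)) andbF.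
have [[w' [h pw']]|nw] :=
    pselect (exists w', i :: w' = w /\ path gtI i w'); last first.
  exists (fun=> 0); split.
  - by move=> y z; rewrite addr0.
  - by move=> pw; move: npw; rewrite pw.
  - by move=> pw; move: ngw; rewrite pw.
  - by move=> w' pw' h; exfalso; apply: nw; exists w'.
case: w / h npw ngw => npw ngw.
pose g (e : E i) (y : word_mod w') : iT i :=
  (tens (be (0 : B) e) (ldinj (exist _ w' pw') y), 0).
have [gDl gDr gb] : bilinear_balanced g.
  split=> [e e' y|e y y'|e b y]; rewrite /g.
  - congr pair; rewrite ?addr0// -tensDl; congr tens; congr pair.
    by rewrite addr0.
  - by rewrite dinjD tensDr; congr pair; rewrite addr0.
  - have -> : be (0 : B) (ract e b) = ract (be (0 : B) e) b.
      by congr pair; rewrite /= [RHS]mul0r.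
    by rewrite tens_bal lact_dinj.
have [phi [phiD phiE]] : exists phi : word_mod (i :: w') -> iT i,
    {morph phi : y z / y + z} /\ forall e y, phi (tcons e y) = g e y.
  case: w' pw' npw ngw @g gDl gDr gb => [|j w'] pw' npw ngw g gDl gDr gb.
    exists (fun e => g e (1 : B)); split=> [y z|e y]; first exact: gDl.
    rewrite /= gb; congr (g e _); exact: (mulr1 (y : B)).
  have gB : bilinear_balanced g by [].
  exists (tlift g); split=> [|e y]; first exact: tliftD.
  exact: tlift_tens.
exists phi; split=> // [pw|pw|v pv h e y].
- by move: npw; rewrite pw.
- by move: ngw; rewrite pw.
- have vw : w' = v by case: h.
  case: v / vw y h pv => y h pv.
  by rewrite (eq_axiomK h) phiE /g (bool_irrelevance pv pw').
Qed.

Lemma ident_bij i : bijective (@ident i).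
Proof.
have ident0 : @ident i 0 = 0.
  by apply: (addIr (@ident i 0)); rewrite -identD !add0r.
have identl u w y : @ident i (tens u (ldinj w y), 0) =
    @winj (word_of_lt w) (lact u.1 y) + @winj (word_cons w) (tcons u.2 y).
  rewrite /ident /= tlift_tens; last exact: ident_lt_balanced.
  rewrite ident_lt_winj; have -> : @ident_gt i 0 = 0.
    by apply: (addIr (@ident_gt i 0)); rewrite -ident_gtD !add0r.
  by rewrite addr0.
have identr w y : @ident i (0, gdinj w y) = @winj (word_of_gt w) y.
  rewrite /ident /= ident_gt_winj; have -> : tlift (@ident_lt i) 0 = 0.
    apply: (addIr (tlift (@ident_lt i) 0)).
    by rewrite -(tliftD (ident_lt_balanced i)) !add0r.
  by rewrite add0r.
pose phi (w : word) := sval (cid (ident_summand_inv i (val w))).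
have phiP (w : word) := svalP (cid (ident_summand_inv i (val w))).
have phiD w : {morph phi w : y z / y + z} by case: (phiP w).
pose k (x : mprod) : iT i := dlift phi x.
have kD : {morph k : x y / x + y} by apply: dliftD.
have k0 : k 0 = 0 by apply: (addIr (k 0)); rewrite -kD !add0r.
have kw w y : k (@winj w y) = phi w y by exact: dlift_dinj.
exists k.
- move=> [t x]; have -> : (t, x) = (t, 0) + (0, x) :> iT i.
    by congr pair; rewrite ?addr0 ?add0r.
  rewrite identD kD; congr (_ + _).
  + elim/tensor_ind_tens: t => [|t u IHt IHu|u y].
    * by rewrite -[X in k X]/(@ident i 0) ident0 k0.
    * have -> : (t + u, 0) = (t, 0) + (u, 0) :> iT i.
        by congr pair; rewrite addr0.
      by rewrite identD kD IHt IHu.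
    * elim/dsum_ind_inj: y => [|y z IHy IHz|w y].
      - have -> : tens u (0 : mprod_lt i) = 0.
          by apply: (addIr (tens u 0)); rewrite -tensDr !add0r.
        by rewrite -[X in k X]/(@ident i 0) ident0 k0.
      - have -> : (tens u (y + z), 0) = (tens u y, 0) + (tens u z, 0) :> iT i.
          by rewrite tensDr; congr pair; rewrite addr0.
        by rewrite identD kD IHy IHz.
      - rewrite identl kD !kw; case: w y => w pw y.
        have [_ p1 _ _] := phiP (word_of_lt (exist _ w pw)).
        have [_ _ _ p2] := phiP (word_cons (exist _ w pw)).
        have -> : phi (word_of_lt (exist _ w pw)) (lact u.1 y) = _ := p1 pw _.
        have -> : phi (word_cons (exist _ w pw)) (tcons u.2 y) = _ :=
          p2 _ pw erefl _ _.
        rewrite -lact_dinj -tens_bal; congr pair; last exact: addr0.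
        rewrite -tensDl; congr tens; case: u => b e; congr pair.
          by rewrite /= addr0; exact: mul1r.
        by rewrite /= ract0 add0r.
  + elim/dsum_ind_inj: x => [|y z IHy IHz|w y].
    * by rewrite -[X in k X]/(@ident i 0) ident0 k0.
    * have -> : (0, y + z) = (0, y) + (0, z) :> iT i.
        by congr pair; rewrite addr0.
      by rewrite identD kD IHy IHz.
    * rewrite identr kw; case: w y => w pw y.
      have [_ _ p _] := phiP (word_of_gt (exist _ w pw)); exact: (p pw y).
- elim/dsum_ind_inj => [|x y IHx IHy|w y].
  + by rewrite k0 ident0.
  + by rewrite kD identD IHx IHy.
  + rewrite -[dinj (F := fun w : word => word_mod (val w)) y]/(winj y) kw.
    case: w y => w sw y.
    rewrite /phi; case: (cid _) => f /= [fD f1 f2 f3].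
    have E2 (v : word) (z : word_mod (val v)) (pv : sorted gtI (val v)) :
        @winj (exist _ (val v) pv) z = winj z.
      by case: v z pv => v pv z pv'; rewrite (bool_irrelevance pv' pv).
    have f0 : f 0 = 0 by apply: (addIr (f 0)); rewrite -fD !add0r.
    have w0 v : @winj v 0 = 0.
      by apply: (addIr (@winj v 0)); rewrite -winjD !add0r.
    have [pw|/negP npw] := pselect (path gtI i w).
      rewrite (f1 pw) identl /= lact1 tcons0 w0 addr0.
      exact: (E2 (exist _ w sw)).
    have [gw|/negP ngw] :=
        pselect (sorted gtI w && (if w is j :: _ then ltI i j else false)).
      by rewrite (f2 gw) identr; exact: (E2 (exist _ w sw)).
    case: w sw y f fD f1 f2 f3 f0 npw ngw => // j w sw y f fD _ _ f3 f0 npw ngw.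
    have ji : j = i.
      apply/val_inj/eqP; move: npw ngw; rewrite /= (sw : path gtI j w) /= andbT /gtI /ltI.
      by rewrite -!leNgt => ij ji; rewrite eq_le ij ji.
    subst j; have pw : path gtI i w by [].
    have H e z : ident (f (tcons e z)) = @winj (exist _ (i :: w) sw) (tcons e z).
      have -> := f3 _ pw erefl e z.
      rewrite identl /= lact0l w0 add0r.
      exact: (E2 (exist _ (i :: w) sw : word) (tcons e z)
                (valP (exist _ w pw : word_lt i))).
    case: w sw y f fD f3 f0 npw ngw pw H => [|j w] sw y f fD _ f0 _ _ pw H.
      by have := H y (1 : B); rewrite /= ract1.
    elim/tensor_ind_tens: y => [|t u IHt IHu|x z]; last exact: H.
      by rewrite f0 ident0 w0.
    by rewrite fD identD IHt IHu -winjD.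
Qed.

Definition ident_inv (i : I) (x : mprod) :
    tensor (BE i) (mprod_lt i) * mprod_gt i :=
  xget 0 [set p | ident p = x].

Lemma ident_invK i : cancel (@ident_inv i) (@ident i).
Proof.
move=> x; have [k _ kK] := ident_bij i.
by rewrite /ident_inv; case: xgetP => [p _ //|/(_ (k x))]; rewrite /= kK.
Qed.

Lemma identK i : cancel (@ident i) (@ident_inv i).
Proof. by move=> p; apply: (bij_inj (ident_bij i)); rewrite ident_invK. Qed.

(* (A (x) I) (+) 0 transported along ident *)
Definition lambda (i : I) (A : BE i -> BE i) (x : mprod) : mprod :=
  let p := ident_inv i x in ident (tmap A id p.1, 0).

(* Phi need only be defined on the operators of L(E^m), but <1, T 1> makes    *)
(* sense for any map T.                                                       *)
Definition cond_exp (T : mprod -> mprod) : B := mprod_ip mprod1 (T mprod1).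

Definition lambda_alg (i : I) : set (mprod -> mprod) :=
  [set @lambda i A | A in [set A | Blinear A]].

(* X_(i_1) X_(i_2) ... for s = [:: i_1; i_2; ...] *)
Definition op_prod (X : I -> mprod -> mprod) (s : seq I) : mprod -> mprod :=
  \big[(fun S T : mprod -> mprod => S \o T)/idfun]_(i <- s) X i.

(* The product formulas for i_m > ... > i_1 < k_1 < ... < k_n: the first two  *)
(* involve only one of the two chains and are stated for that chain alone.    *)
(* One operator X j is given per index j.                                     *)
Definition monotonically_independent (AA : I -> set (mprod -> mprod))
    (Phi : (mprod -> mprod) -> B) : Prop :=
  (forall j, is_subalgebra (AA j)) /\
  forall X : I -> mprod -> mprod, (forall j, AA j (X j)) ->
  [/\ forall i j k : I, ltI i j -> ltI k j ->
        forall S T : mprod -> mprod, Blinear S -> Blinear T ->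
        Phi (S \o X i \o X j \o X k \o T) =
        Phi (S \o X i \o lact (Phi (X j)) \o X k \o T),
      forall (i : I) (s : seq I), path gtI i s ->
        Phi (op_prod X (i :: s)) = \prod_(j <- i :: s) Phi (X j),
      forall (k : I) (t : seq I), path ltI k t ->
        Phi (op_prod X (k :: t)) = \prod_(j <- k :: t) Phi (X j) &
      forall (s : seq I) (i k : I) (t : seq I),
        sorted gtI (rcons s i) -> ltI i k -> path ltI k t ->
        Phi (op_prod X (rcons s i ++ k :: t)) =
        (\prod_(j <- rcons s i) Phi (X j)) * \prod_(j <- k :: t) Phi (X j)].

End MonotonicProduct.

(* Main.v *)
Require Import Defs.
From mathcomp Require Import all_boot all_order all_algebra.
From mathcomp Require Import complex.
From mathcomp Require Import boolp classical_sets cardinality fsbigop reals.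

(** Let [T] be an operator on [E^m]. Since [<1, x>] is the component of [x] in
    the summand [B] of the empty word, [Phi(T)] is that component of [T 1].
    The independence relations then follow from three facts about an element
    [X] of the [i]-th algebra, which only concern the first letter of the
    words occurring in a vector:

    - [X] kills every vector carried by words that begin above [i]
      ([lambda_alg_eq0]);
    - every vector in the range of [X] is carried by words that are empty or
      begin at or below [i] ([lambda_alg_range]);
    - on a vector [x] carried by words that are empty or begin below [i],
      [X x] is [Phi(X) x] plus a vector carried by words that begin with [i]
      ([lambda_alg_lt]): under the identification, [x] is [1 (x) x], and
      [X x = A(1) (x) x] where [A(1)] has [B]-component [Phi(X)].

    For a peak [i < j > k], the range of [X_k] lies where the third fact
    describes [X_j]; the error term begins with [j], so [X_i] kills it and
    [X_j] may be replaced by [Phi(X_j)] ([lambda_alg_peak]).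

    For a decreasing product, the operators to the right of [X_i] leave the
    vector below [i], so [X_i] multiplies its [B]-component on the left by
    [Phi(X_i)] ([cond_exp_decreasing]).

    For an increasing product [X_k ... 1], one proves more, namely that it
    equals [c 1] plus a vector carried by words that begin at or above [k],
    where [c] is the product of the expectations ([op_prod_increasing]). An
    operator of smaller index does not see the error term, and it commutes
    with the right action of [B], in which [c 1 = 1 c]; this yields the
    induction step, and also the factorization of a valley
    ([op_prod_valley]). *)

Set Implicit Arguments.
Unset Strict Implicit.
Unset Printing Implicit Defensive.
Import Order.TTheory GRing.Theory Num.Theory.
Local Open Scope classical_set_scope.
Local Open Scope ring_scope.

(** * Operators that are linear over both actions *)

Section BlinearOperators.
Variables (K : comNzRingType) (B : algType K).

Section OneModule.
Variable M : bimodType B.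
Implicit Types (S T : M -> M) (x y : M).

Lemma BlinearD T x y : Blinear T -> T (x + y) = T x + T y.
Proof. by move=> Tl; have := Tl 1 1 x y; rewrite !lact1 !ract1. Qed.

Lemma Blinear0 T : Blinear T -> T 0 = 0.
Proof. by move=> Tl; apply: (addIr (T 0)); rewrite -BlinearD// !add0r. Qed.

Lemma Blinear_lact T a x : Blinear T -> T (lact a x) = lact a (T x).
Proof.
by move=> Tl; have := Tl a 1 x 0; rewrite !ract1 (Blinear0 Tl) !addr0.
Qed.

Lemma Blinear_ract T a x : Blinear T -> T (ract x a) = ract (T x) a.
Proof.
by move=> Tl; have := Tl 1 a x 0; rewrite !lact1 (Blinear0 Tl) !addr0.
Qed.

Lemma BlinearI T : {morph T : x y / x + y} ->
  (forall a, {morph T : x / lact a x}) -> (forall a, {morph T : x / ract x a}) ->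
  Blinear T.
Proof. by move=> TD Tl Tr b1 b2 x y; rewrite TD Tl Tr. Qed.

Lemma Blinear_cst0 : Blinear (fun _ : M => 0 : M).
Proof. by move=> b1 b2 x y; rewrite ract0 lact0 addr0. Qed.

Lemma Blinear_add S T : Blinear S -> Blinear T ->
  Blinear (fun x => S x + T x).
Proof.
by move=> Sl Tl b1 b2 x y; rewrite Sl Tl ractDl lactDr addrACA.
Qed.

Lemma Blinear_scale (k : K) T : Blinear T -> Blinear (fun x => k *: T x).
Proof. by move=> Tl b1 b2 x y; rewrite Tl scalerDr ractZl lactZr. Qed.

Lemma Blinear_comp S T : Blinear S -> Blinear T -> Blinear (S \o T).
Proof. by move=> Sl Tl b1 b2 x y /=; rewrite Tl Sl. Qed.

End OneModule.

Section TensorId.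
Variables M N : bimodType B.
Implicit Types (S T : M -> M) (t u : tensor M N).

Lemma tens0r (x : M) : tens x (0 : N) = 0.
Proof. by apply: (addIr (tens x 0)); rewrite -tensDr !add0r. Qed.

Lemma Blinear_balanced T : Blinear T -> balanced T (id : N -> N).
Proof.
move=> Tl; split=> // [x x'|x b y]; first exact: BlinearD.
by rewrite Blinear_ract// tens_bal.
Qed.

Lemma tmap_tens T (x : M) (y : N) : Blinear T ->
  tmap T id (tens x y) = tens (T x) y.
Proof. by move=> Tl; rewrite tmap_tsum//; exact: Blinear_balanced. Qed.

Lemma tmapD T t u : Blinear T -> tmap T id (t + u) = tmap T id t + tmap T id u.
Proof.
move=> /Blinear_balanced Tb; rewrite -(tsum_repr t) -(tsum_repr u) -tsum_cat.
by rewrite !tmap_tsum// map_cat tsum_cat.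
Qed.

Lemma tmap0 T : Blinear T -> tmap T id (0 : tensor M N) = 0.
Proof. by move=> Tl; apply: (addIr (tmap T id 0)); rewrite -tmapD// !add0r. Qed.

Lemma Blinear_tmap T : Blinear T ->
  Blinear (tmap T id : tensor M N -> tensor M N).
Proof.
move=> Tl; apply: BlinearI => [t u|a t|a t]; first exact: tmapD.
- elim/tensor_ind_tens: t => [|t u IHt IHu|x y].
  + by rewrite lact0 tmap0// lact0.
  + by rewrite lactDr !tmapD// lactDr IHt IHu.
  + by rewrite lact_tens !tmap_tens// lact_tens Blinear_lact.
- elim/tensor_ind_tens: t => [|t u IHt IHu|x y].
  + by rewrite ract0 tmap0// ract0.
  + by rewrite ractDl !tmapD// ractDl IHt IHu.
  + by rewrite ract_tens !tmap_tens// ract_tens.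
Qed.

Lemma tmap_cst0 t : tmap (fun _ : M => 0 : M) id t = 0.
Proof.
have l0 := @Blinear_cst0 M.
elim/tensor_ind_tens: t => [|t u IHt IHu|x y]; first by rewrite tmap0.
  by rewrite tmapD// IHt IHu addr0.
by rewrite tmap_tens//; apply: (addIr (tens 0 y)); rewrite -tensDl !add0r.
Qed.

Lemma tmap_add S T t : Blinear S -> Blinear T ->
  tmap (fun x => S x + T x) id t = tmap S id t + tmap T id t.
Proof.
move=> Sl Tl; have STl := Blinear_add Sl Tl.
elim/tensor_ind_tens: t => [|t u IHt IHu|x y].
- by rewrite !tmap0// addr0.
- by rewrite !tmapD// IHt IHu addrACA.
- by rewrite !tmap_tens// tensDl.
Qed.

Lemma tmap_scale (k : K) T t : Blinear T ->
  tmap (fun x => k *: T x) id t = k *: tmap T id t.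
Proof.
move=> Tl; have kTl := Blinear_scale k Tl.
elim/tensor_ind_tens: t => [|t u IHt IHu|x y].
- by rewrite !tmap0// scaler0.
- by rewrite !tmapD// IHt IHu scalerDr.
- by rewrite !tmap_tens// -!(lact_scale k) lact_tens.
Qed.

Lemma tmap_comp S T t : Blinear S -> Blinear T ->
  tmap (S \o T) id t = tmap S id (tmap T id t).
Proof.
move=> Sl Tl; have STl := Blinear_comp Sl Tl.
elim/tensor_ind_tens: t => [|t u IHt IHu|x y].
- by rewrite !tmap0.
- by rewrite !tmapD// IHt IHu.
- by rewrite !tmap_tens.
Qed.

End TensorId.
End BlinearOperators.

(** * The action of the representations on summands *)

Section Monotonic.
Variables (R : realType) (B : cstarAlgType R) (I : set int).
Variable E : I -> semiInnerBimodType B.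
Local Notation mprod := (mprod E).
Local Notation mprod1 := (mprod1 E).
Local Notation ldinj i w y :=
  (@dinj _ _ _ (fun w0 : word_lt i => word_mod E (val w0)) w y).
Local Notation gdinj i w y :=
  (@dinj _ _ _ (fun w0 : word_gt i => word_mod E (val w0)) w y).
Implicit Types (i j k : I) (x : mprod).

Lemma lact_tcons i w b (e : E i) (y : word_mod E w) :
  lact b (tcons e y) = tcons (lact b e) y.
Proof. by case: w y => [|j w] y /=; [rewrite lract | rewrite lact_tens]. Qed.

Lemma ract_tcons i w b (e : E i) (y : word_mod E w) :
  ract (tcons e y) b = tcons e (ract y b).
Proof. by case: w y => [|j w] y /=; [rewrite -ractM | rewrite ract_tens]. Qed.

Lemma ident0 i : @ident R B I E i 0 = 0.
Proof. by apply: (addIr (@ident _ _ _ E i 0)); rewrite -identD !add0r. Qed.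

Lemma ident_tens i u (w : word_lt i) (y : word_mod E (val w)) :
  ident (tens u (ldinj i w y), 0) =
  @winj _ _ _ E (word_of_lt w) (lact u.1 y)
  + @winj _ _ _ E (word_cons w) (tcons u.2 y).
Proof.
rewrite /ident /= tlift_tens; last exact: ident_lt_balanced.
have -> : @ident_gt _ _ _ E i 0 = 0.
  by apply: (addIr (@ident_gt _ _ _ E i 0)); rewrite -ident_gtD !add0r.
by rewrite ident_lt_winj addr0.
Qed.

Lemma ident_gdinj i (w : word_gt i) (y : word_mod E (val w)) :
  ident (0, gdinj i w y) = @winj _ _ _ E (word_of_gt w) y.
Proof.
by rewrite /ident /= ident_gt_winj tlift0 ?add0r//; exact: ident_lt_balanced.
Qed.

(** To prove an additive property on the source of the identification, it is
    enough to check elementary tensors whose right factor is in one summand,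
    because [ident] has an explicit value on these. *)
Lemma ident_ind i (Q : tensor (BE E i) (mprod_lt E i) * mprod_gt E i -> Prop) :
  Q 0 -> (forall p q, Q p -> Q q -> Q (p + q)) ->
  (forall u w y, Q (tens u (ldinj i w y), 0)) ->
  (forall w y, Q (0, gdinj i w y)) -> forall p, Q p.
Proof.
move=> Q0 QD Ql Qr [t x].
have -> : (t, x) = (t, 0) + (0, x) by congr pair; rewrite ?addr0 ?add0r.
have QDl t1 t2 : Q (t1, 0) -> Q (t2, 0) -> Q (t1 + t2, 0).
  by move=> Q1 Q2; have := QD _ _ Q1 Q2; congr Q; congr pair; exact: addr0.
apply: (QD (t, 0) (0, x)).
  elim/tensor_ind_tens: t => [//|t1 t2|u y]; first exact: QDl.
  elim/dsum_ind_inj: y => [|y z Qy Qz|w y]; last exact: Ql.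
    by rewrite tens0r.
  by rewrite tensDr; exact: QDl.
elim/dsum_ind_inj: x => [//|x1 x2 Q1 Q2|w y]; last exact: Qr.
by have := QD _ _ Q1 Q2; congr Q; congr pair; exact: addr0.
Qed.

Lemma winj0 (w : word I) : @winj _ _ _ E w 0 = 0.
Proof. by apply: (addIr (@winj _ _ _ E w 0)); rewrite -winjD !add0r. Qed.

Lemma winj_in (w : word I) (y : word_mod E (val w)) : @winj _ _ _ E w y w = y.
Proof. exact: (dinj_in (F := fun u : word I => word_mod E (val u))). Qed.

Lemma winj_out (w v : word I) (y : word_mod E (val w)) :
  w != v -> @winj _ _ _ E w y v = 0.
Proof. exact: (dinj_out (F := fun u : word I => word_mod E (val u))). Qed.

Lemma lact_winj b (w : word I) (y : word_mod E (val w)) :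
  lact b (winj y) = winj (lact b y) :> mprod.
Proof. exact: lact_dinj. Qed.

Lemma ract_winj b (w : word I) (y : word_mod E (val w)) :
  ract (winj y) b = winj (ract y b) :> mprod.
Proof. exact: ract_dinj. Qed.

Lemma ident_lact i b : {morph @ident _ _ _ E i : p / lact b p}.
Proof.
move=> p; elim/ident_ind: p => [|p q IHp IHq|u w y|w y].
- by rewrite lact0 ident0 lact0.
- by rewrite lactDr !identD lactDr IHp IHq.
- rewrite -[lact b (_, _)]/(lact b (tens _ _), lact b (0 : mprod_gt E i)).
  rewrite lact0 lact_tens !ident_tens lactDr !lact_winj lact_tcons.
  by rewrite -lactM.
- rewrite -[lact b (_, _)]/(lact b (0 : tensor _ _), lact b (gdinj i w y)).
  by rewrite lact0 lact_dinj !ident_gdinj lact_winj.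
Qed.

Lemma ident_ract i b : {morph @ident _ _ _ E i : p / ract p b}.
Proof.
move=> p; elim/ident_ind: p => [|p q IHp IHq|u w y|w y].
- by rewrite ract0 ident0 ract0.
- by rewrite ractDl !identD ractDl IHp IHq.
- rewrite -[ract (_, _) b]/(ract (tens _ _) b, ract (0 : mprod_gt E i) b).
  rewrite ract0 ract_tens ract_dinj !ident_tens ractDl !ract_winj ract_tcons.
  by rewrite lract.
- rewrite -[ract (_, _) b]/(ract (0 : tensor _ _) b, ract (gdinj i w y) b).
  by rewrite ract0 ract_dinj !ident_gdinj ract_winj.
Qed.

Lemma lambda_ident i (A : BE E i -> BE E i) p :
  lambda A (ident p) = ident (tmap A id p.1, 0).
Proof. by rewrite /lambda identK. Qed.

Lemma Blinear_lambda i (A : BE E i -> BE E i) : Blinear A -> Blinear (lambda A).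
Proof.
move=> /(@Blinear_tmap _ _ _ (mprod_lt E i)) Al; apply: BlinearI => [x y|b x|b x].
- rewrite -(ident_invK i x) -(ident_invK i y) -identD !lambda_ident -identD /=.
  by rewrite BlinearD//; congr ident; congr pair; rewrite addr0.
- rewrite -(ident_invK i x) -ident_lact !lambda_ident -ident_lact /=.
  by rewrite Blinear_lact//; congr ident; congr pair; rewrite lact0.
- rewrite -(ident_invK i x) -ident_ract !lambda_ident -ident_ract /=.
  by rewrite Blinear_ract//; congr ident; congr pair; rewrite ract0.
Qed.

Lemma lambda_alg_Blinear i X : lambda_alg (E:=E) i X -> Blinear X.
Proof. by case=> A Al <-; exact: Blinear_lambda. Qed.

(** Each algebraic operation on [L(B (+) E_i)] is carried to the same one on
    [L(E^m)], because [ident] is a bijective bimodule map. *)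
Lemma lambda_alg_subalgebra i : is_subalgebra (lambda_alg (E:=E) i).
Proof.
split.
- by move=> X; exact: lambda_alg_Blinear.
- exists (fun=> 0); first exact: Blinear_cst0.
  by apply/funext => x; rewrite /lambda tmap_cst0; exact: ident0.
- move=> _ _ [S Sl <-] [T Tl <-].
  exists (fun u => S u + T u); first exact: Blinear_add.
  apply/funext => x; rewrite /lambda tmap_add// -identD.
  by congr ident; congr pair; rewrite addr0.
- move=> k _ [T Tl <-]; exists (fun u => k *: T u); first exact: Blinear_scale.
  apply/funext => x; rewrite /lambda tmap_scale// -!(lact_scale k) -ident_lact.
  by congr ident; congr pair; rewrite lact0.
- move=> _ _ [S Sl <-] [T Tl <-].
  exists (S \o T); first exact: Blinear_comp.
  by apply/funext => x; rewrite /= {1 3}/lambda lambda_ident tmap_comp.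
Qed.

(** * Vectors carried by words with a given first letter *)

(** In contrapositive form, so that it passes to sums and to images of linear
    maps by rewriting components to [0]. *)
Definition supported (P : pred (seq I)) x : Prop :=
  forall w : word I, ~~ P (val w) -> x w = 0.

Definition starts (p : pred I) (w : seq I) : bool :=
  if w is j :: _ then p j else false.

Definition starts0 (p : pred I) (w : seq I) : bool :=
  if w is j :: _ then p j else true.

Lemma sub_supported (P Q : pred (seq I)) x :
  (forall w, P w -> Q w) -> supported P x -> supported Q x.
Proof. by move=> PQ Px w /(contra (PQ _)); exact: Px. Qed.

Lemma supportedD P x y : supported P x -> supported P y -> supported P (x + y).
Proof. by move=> Px Py w nP; rewrite dsumD Px// Py// addr0. Qed.

Lemma supported_ract P b x : supported P x -> supported P (ract x b).
Proof.
by move=> Px w nP; rewrite -[LHS]/(ract (x w) b) Px// ract0.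
Qed.

Lemma supported_winj (P : pred (seq I)) (w : word I) (y : word_mod E (val w)) :
  P (val w) -> supported P (winj y).
Proof.
move=> Pw v nP; apply: winj_out; apply: contraNneq nP => <-; exact: Pw.
Qed.

(** A vector is the finite sum of its components, and those at words outside
    [P] vanish; so additive statements on supported vectors reduce to single
    summands. *)
Lemma supported_ind (P : pred (seq I)) (Q : mprod -> Prop) :
  Q 0 -> (forall x y, Q x -> Q y -> Q (x + y)) ->
  (forall (w : word I) (y : word_mod E (val w)), P (val w) -> Q (winj y)) ->
  forall x, supported P x -> Q x.
Proof.
move=> Q0 QD Qw x Px; rewrite (dsum_eq_lift x) /dlift.
elim/big_ind: _ => // w _.
have [Pw|/Px ->] := boolP (P (val w)); first exact: Qw.
rewrite -[dinj _]/(winj (0 : word_mod E (val w))) winj0; exact: Q0.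
Qed.

(** A word carries a proof that it is decreasing, and the several embeddings
    of words below or above [i] produce different ones for the same letters. *)
Lemma word_ofE (w : seq I) (s s' : sorted (@gtI I) w) (y : word_mod E w) :
  @winj _ _ _ E (exist _ w s) y = @winj _ _ _ E (exist _ w s') y.
Proof. by rewrite (bool_irrelevance s s'). Qed.

(** These vectors form [E^m_(>i)], where [lambda A] is zero by definition. *)
Lemma lambda_eq0 i (A : BE E i -> BE E i) x : Blinear A ->
  supported (starts (ltI i)) x -> lambda A x = 0.
Proof.
move=> Al; have Ll := Blinear_lambda Al; move: x; apply: supported_ind.
- exact: Blinear0.
- by move=> x y x0 y0; rewrite BlinearD// x0 y0 addr0.
- move=> [w s] y /= iw; pose w' : word_gt i := exist _ w (introT andP (conj s iw)).
  rewrite (word_ofE s (proj1 (andP (valP w')))) -(@ident_gdinj i w').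
  by rewrite lambda_ident tmap0// ident0.
Qed.

(** The range lies in the image of the tensor part, and [(b, e) (x) y] goes to
    [b y], whose words are empty or begin below [i], plus [e (x) y], whose
    words begin with [i]. *)
Lemma lambda_range i (A : BE E i -> BE E i) x :
  supported (starts0 (fun j => ~~ ltI i j)) (lambda A x).
Proof.
suff H (p : tensor (BE E i) (mprod_lt E i) * mprod_gt E i) :
    supported (starts0 (fun j => ~~ ltI i j)) (ident (p.1, 0)).
  exact: (H (tmap A id (ident_inv i x).1, 0)).
elim/ident_ind: p => [|p q Sp Sq|u w y|w y] /=; rewrite ?ident0//.
- have -> : (p.1 + q.1, 0 : mprod_gt E i) = (p.1, 0) + (q.1, 0).
    by congr pair; rewrite addr0.
  by rewrite identD; exact: supportedD.
- rewrite ident_tens; apply: supportedD; apply: supported_winj => /=.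
    case: w {y} => -[|j w] //= /andP[ji _]; move: ji.
    by rewrite /gtI /ltI -leNgt => /ltW.
  by rewrite /ltI ltxx.
Qed.

(** Here [x] corresponds to [(1, 0) (x) x], hence [lambda A x] to
    [A (1, 0) (x) x]; the difference is the part of it coming from the
    [E_i]-component of [A (1, 0)]. *)
Lemma lambda_lt i (A : BE E i -> BE E i) x : Blinear A ->
  supported (starts0 (gtI i)) x ->
  supported (starts (pred1 i))
    (lambda A x - lact (A ((1 : B) : regular_bimod B, 0)).1 x).
Proof.
move=> Al; have Ll := Blinear_lambda Al; move: x; apply: supported_ind.
- by rewrite (Blinear0 Ll) lact0 subr0.
- move=> x y Sx Sy; rewrite BlinearD// lactDr opprD addrACA.
  exact: supportedD.
- move=> [w s] y /= wi.
  have pw : path (@gtI I) i w by case: w wi s {y} => //= j w -> ->.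
  pose w' : word_lt i := exist _ w pw.
  set u := A _.
  have -> : @winj _ _ _ E (exist _ w s) y = @winj _ _ _ E (word_of_lt w') y.
    exact: word_ofE.
  have wE : @winj _ _ _ E (word_of_lt w') y =
      ident (tens ((1 : B) : regular_bimod B, 0 : E i) (ldinj i w' y), 0).
    by rewrite ident_tens /= lact1 tcons0 winj0 addr0.
  rewrite [X in lambda A X]wE lambda_ident /= tmap_tens// -/u ident_tens.
  rewrite lact_winj addrAC subrr add0r.
  by apply: supported_winj; exact: eqxx.
Qed.

(** * The expectation as a vacuum component *)

Definition vac x : B := x (word_nil I).

Lemma vacD x y : vac (x + y) = vac x + vac y.
Proof. by []. Qed.
Lemma vac_lact b x : vac (lact b x) = b * vac x.
Proof. by []. Qed.
Lemma vac_ract b x : vac (ract x b) = vac x * b.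
Proof. by []. Qed.
Lemma vac1 : vac mprod1 = 1.
Proof. exact: (@winj_in (word_nil I)). Qed.
Lemma vac_starts p x : supported (starts p) x -> vac x = 0.
Proof. by move=> /(_ (word_nil I) isT). Qed.

Lemma star1 : star (1 : B) = 1.
Proof. by rewrite -[LHS]mul1r -{1}[1]starK -starM mul1r starK. Qed.

(** The pairing with [1] only involves the summand of the empty word, where it
    is [star 1 * b]. That the vacuum vector is nonzero holds because [1 != 0] in
    [B], and makes this summand occur in the sum defining the pairing. *)
Lemma cond_expE (T : mprod -> mprod) : cond_exp T = vac (T mprod1).
Proof.
rewrite /cond_exp /mprod_ip.
have -> : [set w : word I | mprod1 w != 0] = [set word_nil I].
  apply/seteqP; split=> [w /=|_ ->]; last first.
    by have : vac mprod1 != 0 by rewrite vac1 oner_neq0.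
  by apply: contraNP => wn; apply/eqP/winj_out; apply/eqP => nw; apply: wn.
transitivity (word_ip (mprod1 (word_nil I)) (T mprod1 (word_nil I))).
  exact: (@fsbig_set1 _ _ _ _ _
           (fun w : word I => word_ip (mprod1 w) (T mprod1 w))).
rewrite -[LHS]/(star (vac mprod1) * vac (T mprod1)).
by rewrite vac1 star1 mul1r.
Qed.

(** Both sides are [b] in the summand [B]. This lets a scalar of [B] pass to
    the right of operators, with no commutation in [B]. *)
Lemma lact_mprod1 b : lact b mprod1 = ract mprod1 b.
Proof.
by rewrite lact_winj ract_winj; congr winj; rewrite /= [LHS]mulr1 [RHS]mul1r.
Qed.

Lemma mprod1_supported p : supported (starts0 p) mprod1.
Proof. exact: supported_winj. Qed.

Section OneOperator.
Variables (i : I) (X : mprod -> mprod).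
Hypothesis XA : lambda_alg (E:=E) i X.

Lemma lambda_alg_eq0 x : supported (starts (ltI i)) x -> X x = 0.
Proof. by case: XA => A Al <-; exact: lambda_eq0. Qed.

Lemma lambda_alg_range x : supported (starts0 (fun j => ~~ ltI i j)) (X x).
Proof. by case: XA => A Al <-; exact: lambda_range. Qed.

(** Applying [lambda_lt] to the vector [1] itself identifies the
    [B]-component of [A (1, 0)] with the expectation. *)
Lemma lambda_alg_lt x : supported (starts0 (gtI i)) x ->
  supported (starts (pred1 i)) (X x - lact (cond_exp X) x).
Proof.
case: XA => A Al <- Sx; set a := (A ((1 : B) : regular_bimod B, 0)).1.
suff -> : cond_exp (lambda A) = a by exact: lambda_lt.
have := vac_starts (lambda_lt Al (@mprod1_supported (gtI i))).
rewrite cond_expE -lactN vacD vac_lact.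
have -> : vac (- mprod1) = -1 by rewrite -vac1.
by rewrite mulrN1 => /subr0_eq.
Qed.

Lemma vac_lambda_alg x : supported (starts0 (gtI i)) x ->
  vac (X x) = cond_exp X * vac x.
Proof.
by move=> /lambda_alg_lt /vac_starts Sx; apply: subr0_eq; rewrite -[RHS]Sx.
Qed.

(** The remainder of [x] is killed, so [X x = X (c 1) = X (1 c) = (X 1) c]. *)
Lemma lambda_alg_vacuum c x : supported (starts (ltI i)) (x - lact c mprod1) ->
  X x = ract (X mprod1) c.
Proof.
move=> Sx; have Xl := lambda_alg_Blinear XA.
rewrite -[x in LHS](subrK (lact c mprod1)) BlinearD// lambda_alg_eq0// add0r.
by rewrite lact_mprod1 Blinear_ract.
Qed.

End OneOperator.

(** [Z x] lies below [j], so [Y (Z x)] differs from [Phi(Y) (Z x)] by words that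
    begin with [j > i], which [X] kills. *)
Lemma lambda_alg_peak i j k (X Y Z : mprod -> mprod) x :
  lambda_alg i X -> lambda_alg j Y -> lambda_alg k Z -> ltI i j -> ltI k j ->
  X (Y (Z x)) = X (lact (cond_exp Y) (Z x)).
Proof.
move=> XA YA ZA ij kj; have Xl := lambda_alg_Blinear XA.
have SZ : supported (starts0 (gtI j)) (Z x).
  apply: sub_supported (lambda_alg_range ZA x) => -[//|l w] /=.
  by rewrite /gtI /ltI -leNgt => lk; exact: le_lt_trans lk kj.
rewrite -[Y _ in LHS](subrK (lact (cond_exp Y) (Z x))) BlinearD//.
rewrite (lambda_alg_eq0 XA) ?add0r//.
by apply: sub_supported (lambda_alg_lt YA SZ) => -[//|l w] /= /eqP ->.
Qed.

(** * Products along monotone chains *)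

Section Products.
Variable X : I -> mprod -> mprod.
Hypothesis XA : forall j, lambda_alg (E:=E) j (X j).

Lemma op_prod_cons i s : op_prod X (i :: s) = X i \o op_prod X s.
Proof. by rewrite /op_prod big_cons. Qed.

Lemma op_prod_nil : op_prod X [::] = idfun.
Proof. by rewrite /op_prod big_nil. Qed.

Lemma op_prod_cat s t : op_prod X (s ++ t) = op_prod X s \o op_prod X t.
Proof.
by elim: s => [|i s IH]; rewrite ?op_prod_nil //= !op_prod_cons IH.
Qed.

Lemma Blinear_op_prod s : Blinear (op_prod X s).
Proof.
elim: s => [|i s IH]; first by rewrite op_prod_nil.
rewrite op_prod_cons; apply: Blinear_comp => //; exact: lambda_alg_Blinear.
Qed.

(** The value on [1] of the factors after the first one is carried by words
    below the first index, so each factor multiplies the vacuum component on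
    the left by its expectation. *)
Lemma cond_exp_decreasing s : sorted (@gtI I) s ->
  cond_exp (op_prod X s) = \prod_(j <- s) cond_exp (X j).
Proof.
elim: s => [|i s IH] /= => [_|si]; first by rewrite big_nil cond_expE op_prod_nil vac1.
rewrite big_cons -IH ?(path_sorted si)// cond_expE op_prod_cons /=.
rewrite (vac_lambda_alg (XA i)) -?cond_expE//.
case: s si {IH} => [_|j s /andP[ji _]]; first by rewrite op_prod_nil; exact: mprod1_supported.
rewrite op_prod_cons; apply: sub_supported (lambda_alg_range (XA j) _) => -[//|l w] /=.
by rewrite /gtI /ltI -leNgt => lj; exact: le_lt_trans lj ji.
Qed.

(** Knowing the vacuum component alone would not support an induction: the next
    operator acts on the whole vector, and it must be known that it kills the
    rest. [c 1] is produced as [(X_k 1) c'], so the new remainder is that of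
    [X_k 1] multiplied by [c'] on the right. *)
Lemma op_prod_increasing k t : path (@ltI I) k t ->
  supported (starts (fun j => ~~ ltI j k))
    (op_prod X (k :: t) mprod1 - lact (\prod_(j <- k :: t) cond_exp (X j)) mprod1).
Proof.
elim: t k => [|l t IH] k /= kt.
  rewrite op_prod_cons op_prod_nil /= big_seq1.
  apply: sub_supported (lambda_alg_lt (XA k) (@mprod1_supported _)) => -[//|j w] /=.
  by move=> /eqP ->; rewrite /ltI ltxx.
case/andP: kt => kl lt; set c := \prod_(j <- l :: t) cond_exp (X j).
rewrite op_prod_cons /= (lambda_alg_vacuum (XA k) (c := c)); last first.
  apply: sub_supported (IH l lt) => -[//|j w] /=.
  by rewrite /ltI -leNgt; exact: lt_le_trans.
rewrite big_cons -/c lactM lact_mprod1 -lract -ractN -ractDl.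
apply: supported_ract.
apply: sub_supported (lambda_alg_lt (XA k) (@mprod1_supported _)) => -[//|j w] /=.
by move=> /eqP ->; rewrite /ltI ltxx.
Qed.

Lemma cond_exp_increasing k t : path (@ltI I) k t ->
  cond_exp (op_prod X (k :: t)) = \prod_(j <- k :: t) cond_exp (X j).
Proof.
move=> /op_prod_increasing /vac_starts; rewrite -lactN vacD vac_lact cond_expE.
have -> : vac (- mprod1) = -1 by rewrite -vac1.
by rewrite mulrN1 => /subr0_eq.
Qed.

(** The lowest operator [X_i] only sees [c 1 = 1 c] of the increasing part, so
    the whole product sends [1] to the decreasing part applied to [1], times
    [c] on the right. *)
Lemma op_prod_valley s i k t : ltI i k -> path (@ltI I) k t ->
  cond_exp (op_prod X (rcons s i ++ k :: t)) =
  cond_exp (op_prod X (rcons s i)) * \prod_(j <- k :: t) cond_exp (X j).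
Proof.
move=> ik kt; set c := \prod_(j <- k :: t) _.
rewrite !cond_expE op_prod_cat -cats1 op_prod_cat op_prod_cons op_prod_nil /=.
rewrite (lambda_alg_vacuum (XA i) (c := c)).
  by rewrite Blinear_ract ?vac_ract//; exact: Blinear_op_prod.
apply: sub_supported (op_prod_increasing kt) => -[//|j w] /=.
by rewrite /ltI -leNgt; exact: lt_le_trans.
Qed.

End Products.
End Monotonic.

Theorem theorem4p1 (R : realType) (B : cstarAlgType R) (I : set int)
    (E : I -> semiInnerBimodType B) :
  monotonically_independent (@lambda_alg R B I E) (@cond_exp R B I E).
Proof.
split=> [j|X XA]; first exact: lambda_alg_subalgebra.
split.
- move=> i j k ij kj S T _ _; rewrite !cond_expE /=.
  by rewrite (lambda_alg_peak _ (XA i) (XA j) (XA k)) ?cond_expE.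
- by move=> i s; exact: (@cond_exp_decreasing _ _ _ _ _ XA (i :: s)).
- by move=> k t; exact: cond_exp_increasing.
- move=> s i k t si ik kt.
  by rewrite op_prod_valley// cond_exp_decreasing.
Qed.
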